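(* Let $\mathfrak{X}$ be a fusion action system of a finite $p$-group $S$ on a finite set $X$. Then $\mathfrak{X}$ is saturated if and only if every $\mathfrak{X}$-conjugacy class of subgroups of $S$ contains a subgroup that is both fully automized and receiving.
   Context: Let $p$ be a prime, $S$ a finite $p$-group, and $X$ a finite set with a left $S$-action; $\Sigma_X$ is the symmetric group on $X$, $\ell_s\in\Sigma_X$ is the permutation $x\mapsto s\cdot x$, and $c_s$ is conjugation $h\mapsto shs^{-1}$. $\mathrm{Inj}(P,Q)$ is the set of injective homomorphisms $P\to Q$. A pair $(\varphi,\sigma)\in\mathrm{Inj}(P,Q)\times\Sigma_X$ ($P,Q\le S$) is intertwined if $\sigma\ell_p\sigma^{-1}=\ell_{\varphi(p)}$ for all $p\in P$. Let $\mathfrak{U}$ be the category whose objects are all subgroups of $S$, whose morphisms $P\to Q$ are the intertwined pairs, composed componentwise. Let $\mathfrak{X}_S\subseteq\mathfrak{U}$ have the same objects and morphisms $P\to Q$ the pairs $(c_s|_P,\ell_s)$ with $s\in S$, $sPs^{-1}\le Q$. A fusion action system of $S$ on $X$ is a category $\mathfrak{X}$ with $\mathfrak{X}_S\subseteq\mathfrak{X}\subseteq\mathfrak{U}$ such that every morphism of $\mathfrak{X}$ factors as an isomorphism of $\mathfrak{X}$ followed by an inclusion $(\mathrm{incl},\mathrm{id}_X)$. Write $\mathfrak{X}(P)=\mathfrak{X}(P,P)$ and $\mathfrak{X}(P,Q)_{\mathrm{iso}}$ for the isomorphisms. The underlying fusion system $\mathcal{F}^{\mathfrak{X}}$ has the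 subgroups of $S$ as objects and $\mathcal{F}^{\mathfrak{X}}(P,Q)=\{\varphi : \exists\sigma,\ (\varphi,\sigma)\in\mathfrak{X}(P,Q)\}$; two subgroups are ($\mathfrak{X}$-)conjugate if they are isomorphic in $\mathfrak{X}$ (equivalently in $\mathcal{F}^{\mathfrak{X}}$). Let $C=\{s\in S:\ell_s=\mathrm{id}_X\}$, $N_S(P;X)=N_S(P)\cap C$, $Z_S(P;X)=Z_S(P)\cap C$. A subgroup $P\le S$ is fully normalized (resp. fully centralized, fully $X$-normalized, fully $X$-centralized) if $|N_S(P)|\ge|N_S(Q)|$ (resp. the same inequality for $Z_S(-)$, $N_S(-;X)$, $Z_S(-;X)$) for all $Q$ conjugate to $P$. Put $\mathrm{Aut}_S(P)=\{c_s|_P:s\in N_S(P)\}$, $\mathrm{Aut}_S(P;X)=\{(c_s|_P,\ell_s):s\in N_S(P)\}$, $\Sigma_{\mathfrak{X}}(P)=\{\sigma:\exists\varphi,(\varphi,\sigma)\in\mathfrak{X}(P)\}$, $\Sigma^S_{\mathfrak{X}}(P)=\{\ell_s:s\in N_S(P)\}$, $\mathcal{F}^{\mathfrak{X}}(P)_0=\{\varphi:(\varphi,\mathrm{id}_X)\in\mathfrak{X}(P)\}$, $\mathcal{F}_S(P)_0=\{c_s|_P:s\in N_S(P;X)\}$, $\Sigma_{\mathfrak{X}}(P)_0=\{\sigma:(\mathrm{id}_P,\sigma)\in\mathfrak{X}(P)\}$, $\Sigma^S_{\mathfrak{X}}(P)_0=\{\ell_s:s\in Z_S(P)\}$. The extender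 of $(\varphi,\sigma)\in\mathfrak{X}(P,Q)_{\mathrm{iso}}$ is $N_{(\varphi,\sigma)}=\{n\in N_S(P):(\varphi c_n\varphi^{-1},\sigma\ell_n\sigma^{-1})\in\mathrm{Aut}_S(Q;X)\}$. $\mathfrak{X}$ is saturated if: (1) for every $P\le S$, fully normalized implies fully $X$-normalized and fully centralized, and each of fully $X$-normalized and fully centralized implies fully $X$-centralized; (2) if $P$ is fully normalized then $\mathrm{Aut}_S(P)\in\mathrm{Syl}_p(\mathcal{F}^{\mathfrak{X}}(P))$, $\mathrm{Aut}_S(P;X)\in\mathrm{Syl}_p(\mathfrak{X}(P))$ and $\Sigma^S_{\mathfrak{X}}(P)\in\mathrm{Syl}_p(\Sigma_{\mathfrak{X}}(P))$; (3) if $P$ is fully $X$-normalized then $\mathcal{F}_S(P)_0\in\mathrm{Syl}_p(\mathcal{F}^{\mathfrak{X}}(P)_0)$; (4) if $P$ is fully centralized then $\Sigma^S_{\mathfrak{X}}(P)_0\in\mathrm{Syl}_p(\Sigma_{\mathfrak{X}}(P)_0)$; (5) if $Q$ is fully $X$-centralized and $(\varphi,\sigma)\in\mathfrak{X}(P,Q)_{\mathrm{iso}}$, there is $(\widetilde\varphi,\sigma)\in\mathfrak{X}(N_{(\varphi,\sigma)},S)$ with $\widetilde\varphi|_P=\varphi$. $P\le S$ is fully automized if $\mathrm{Aut}_S(P;X)\in\mathrm{Syl}_p(\mathfrak{X}(P))$. $P$ is receiving if for all $Q\le S$ and $(\varphi,\sigma)\in\mathfrak{X}(Q,P)_{\mathrm{iso}}$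 there is $(\widetilde\varphi,\sigma)\in\mathfrak{X}(N_{(\varphi,\sigma)},S)$ with $\widetilde\varphi|_Q=\varphi$. *)

(* Defs.v *)
From mathcomp Require Import all_boot all_fingroup all_solvable.

Set Implicit Arguments.
Unset Strict Implicit.
Unset Printing Implicit Defensive.

Import GroupScope.

(* Conventions.
   - The finite p-group is a whole finGroupType S, so its subgroups are the
     P : {group S}, and N_S(P), Z_S(P) (the centralizer of P in S) are 'N(P),
     'C(P).
   - A homomorphism defined on P is encoded by the unique finite function
     S -> S that agrees with it on P and is 1 outside P; equality of encodings
     is then equality of homomorphisms, and composition is plain composition.
   - Products in {perm X} are read left to right: the composite "sigma after
     tau" is tau * sigma, and sigma o ell o sigma^-1 is ell ^ sigma.  Likewise
     s h s^-1 is h ^ s^-1.  *)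

Section FusionActionSystems.

Context (p : nat) (S : finGroupType) (X : finType) (to : {action S &-> X}).

Implicit Types (P Q R : {group S}) (f g : {ffun S -> S}).

(* MathComp actions are right actions: the left action of s sends x to
   to x s^-1. *)
Definition ell (s : S) : {perm X} := actperm to s^-1.

Definition restr (A : {set S}) (f : S -> S) : {ffun S -> S} :=
  [ffun x => if x \in A then f x else 1].

Definition incl (A : {set S}) : {ffun S -> S} := restr A id.

Definition conjmap (A : {set S}) (s : S) : {ffun S -> S} :=
  restr A (fun h => h ^ s^-1).

(* g after f *)
Definition compf g f : {ffun S -> S} := [ffun x => g (f x)].

Definition invf (A : {set S}) f : {ffun S -> S} :=
  [ffun y => odflt 1 [pick x in A | f x == y]].

Definition Inj P Q : {set {ffun S -> S}} :=
  [set f | [&& f \in pffun_on 1 (mem P) (mem Q), morphic P f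
             & dinjectiveb f (mem P)]].

Definition mor : finType := ({ffun S -> S} * {perm X})%type.

(* v after u *)
Definition compm (v u : mor) : mor := (compf v.1 u.1, u.2 * v.2).

Definition inclm (A : {set S}) : mor := (incl A, 1).

Definition conjm_ell (A : {set S}) (s : S) : mor := (conjmap A s, ell s).

Definition intertwined P (u : mor) : bool :=
  [forall x in P, ell x ^ u.2 == ell (u.1 x)].

Definition homsets : Type := {group S} -> {group S} -> {set mor}.

Lemma InjP P Q f : reflect
  [/\ {in P &, {morph f : x y / x * y}}, {in P &, injective f},
      {in P, forall x, f x \in Q} & forall x, x \notin P -> f x = 1]
  (f \in Inj P Q).
Proof.
rewrite inE; apply: (iffP and3P).
  move=> [/pffun_onP[s r] /morphicP m /dinjectiveP i].
  split=> // [x xP|x xP]; first by apply: r; apply: image_f.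
  by apply/eqP/contraT => fx; case/negP: xP; move/subsetP: s; apply.
move=> [m i r s]; split; [apply/pffun_onP; split|exact/morphicP|exact/dinjectiveP].
  by apply/subsetP => x; apply: contraR => xP; apply/eqP/s.
by move=> _ /imageP[x xP ->]; apply: r.
Qed.

Definition U_hom : homsets := fun P Q =>
  [set u : mor | (u.1 \in Inj P Q) && intertwined P u].

Definition XS_hom : homsets := fun P Q =>
  [set conjm_ell P s | s in [set s | P :^ s^-1 \subset Q]].

Lemma ellM s t : ell (t * s) = ell s * ell t.
Proof. by rewrite /ell invMg morphM ?inE. Qed.

Lemma conjmapM P s t : s \in 'N(P) ->
  compf (conjmap P t) (conjmap P s) = conjmap P (t * s).
Proof.
move=> sN; apply/ffunP => x; rewrite !ffunE.
have [xP|xP] := boolP (x \in P); last by rewrite conj1g if_same.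
by rewrite memJ_norm ?groupV // xP invMg conjgM.
Qed.

Section System.

Context (XX : homsets).

Definition X_iso P Q : {set mor} :=
  [set u in XX P Q | [exists v in XX Q P,
     (compm v u == inclm P) && (compm u v == inclm Q)]].

(* Identities need not be required separately: they are the (c_1, ell_1). *)
Record fusion_action_system : Prop := FusionActionSystem {
  fas_contains_XS : forall P Q, XS_hom P Q \subset XX P Q;
  fas_sub_U : forall P Q, XX P Q \subset U_hom P Q;
  fas_comp : forall P Q R u v,
    u \in XX P Q -> v \in XX Q R -> compm v u \in XX P R;
  fas_factor : forall P Q u, u \in XX P Q ->
    exists R (v : mor),
      [/\ R \subset Q, v \in X_iso P R & u = compm (inclm R) v]
}.

Definition X_conjugate P Q : Prop := exists u, u \in X_iso P Q.

Definition F_hom P Q : {set {ffun S -> S}} :=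
  [set f | [exists sigma : {perm X}, (f, sigma) \in XX P Q]].

Definition kerX : {set S} := [set s | ell s == 1].
Definition NX (A : {set S}) : {set S} := 'N(A) :&: kerX.
Definition ZX (A : {set S}) : {set S} := 'C(A) :&: kerX.

Definition fully_normalized P : Prop :=
  forall Q, X_conjugate P Q -> #|'N(Q)| <= #|'N(P)|.
Definition fully_centralized P : Prop :=
  forall Q, X_conjugate P Q -> #|'C(Q)| <= #|'C(P)|.
Definition fully_X_normalized P : Prop :=
  forall Q, X_conjugate P Q -> #|NX Q| <= #|NX P|.
Definition fully_X_centralized P : Prop :=
  forall Q, X_conjugate P Q -> #|ZX Q| <= #|ZX P|.

Definition AutS P : {set {ffun S -> S}} := [set conjmap P s | s in 'N(P)].
Definition AutSX P : {set mor} := [set conjm_ell P s | s in 'N(P)].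
Definition Sigma P : {set {perm X}} :=
  [set sigma | [exists f : {ffun S -> S}, (f, sigma) \in XX P P]].
Definition SigmaS P : {set {perm X}} := [set ell s | s in 'N(P)].
Definition F0 P : {set {ffun S -> S}} := [set f | (f, 1) \in XX P P].
Definition FS0 P : {set {ffun S -> S}} := [set conjmap P s | s in NX P].
Definition Sigma0 P : {set {perm X}} :=
  [set sigma | (incl P, sigma) \in XX P P].
Definition SigmaS0 P : {set {perm X}} := [set ell s | s in 'C(P)].

(* To apply p.-Sylow, which needs subsets of a finGroupType, sets of
   automorphisms of P (resp. of pairs) are carried over to Aut P, a group of
   permutations of S supported on P.  The product there is opposite to
   composition, which affects neither subgroups nor orders. *)
Definition perms_of P (A : {set {ffun S -> S}}) : {set {perm S}} :=
  [set a in Aut P | restr P a \in A].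
Definition perm_pairs_of P (A : {set mor}) : {set {perm S} * {perm X}} :=
  [set u | (u.1 \in Aut P) && ((restr P u.1, u.2) \in A)].

Lemma restrM P a b : a \in Aut P -> b \in Aut P ->
  compf (restr P b) (restr P a) = restr P (a * b : {perm S}).
Proof.
move=> aA bA; apply/ffunP => x; rewrite !ffunE permM.
have [xP|xP] := boolP (x \in P); first by rewrite (Aut_closed aA xP).
by rewrite group1 -(autmE bA) morph1.
Qed.

Lemma group_set_perm_pairs_of P :
  fusion_action_system -> group_set (perm_pairs_of P (XX P P)).
Proof.
move=> sys; apply/group_setP; split.
  rewrite inE group1 /=; apply: (subsetP (fas_contains_XS sys P P)).
  apply/imsetP; exists 1; first by rewrite inE invg1 conjsg1.
  rewrite /conjm_ell; congr (_, _); last by rewrite /ell invg1 morph1.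
  by apply/ffunP=> x; rewrite !ffunE perm1 invg1 conjg1.
move=> [a x] [b y] /setIdP[/= aA H1] /setIdP[/= bA H2].
rewrite inE groupM //= -restrM //; exact: (fas_comp sys H1 H2).
Qed.

Lemma perm_pairs_of_surj P u : fusion_action_system -> u \in XX P P ->
  exists2 a, (a, u.2) \in perm_pairs_of P (XX P P) & restr P a = u.1.
Proof.
move=> sys uX; have := subsetP (fas_sub_U sys P P) _ uX.
rewrite inE => /andP[/InjP[m i r s] _].
pose h := Morphism m.
have ih : 'injm h by apply/injmP.
have hP : h @* P = P.
  apply/eqP; rewrite eqEcard card_injm // leqnn andbT.
  by apply/subsetP=> _ /morphimP[x _ xP ->]; apply: r.
have E : restr P (aut ih hP) = u.1.
  apply/ffunP=> x; rewrite ffunE; case: ifP => xP; first by rewrite autE.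
  by rewrite s ?xP.
by exists (aut ih hP) => //; rewrite inE Aut_aut /= E -surjective_pairing.
Qed.

Definition extender_set P Q (u : mor) : {set S} :=
  [set n in 'N(P) |
     (compf u.1 (compf (conjmap P n) (invf P u.1)), ell n ^ u.2) \in AutSX Q].

(* When u is an isomorphism from P to Q, extender_set P Q u is already a
   subgroup (extenderE below); generating makes it a {group S} for all u. *)
Definition extender P Q (u : mor) : {group S} := <<extender_set P Q u>>%G.

Lemma group_set_extender P Q u : fusion_action_system -> u \in X_iso P Q ->
  group_set (extender_set P Q u).
Proof.
move=> sys; rewrite inE => /andP[uX] /existsP[v /andP[vX /andP[/eqP vu /eqP uv]]].
have := subsetP (fas_sub_U sys P Q) _ uX.
rewrite inE => /andP[/InjP[m i r s] _].
have f1 : u.1 1 = 1 by apply: (mulgI (u.1 1)); rewrite -m // !mulg1.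
have inv x : x \in P -> invf P u.1 (u.1 x) = x.
  move=> xP; rewrite ffunE; case: pickP => [y /andP[yP /eqP]|/(_ x)].
    by move/i => ->.
  by rewrite xP eqxx.
have invP y : invf P u.1 y \in P.
  by rewrite ffunE; case: pickP => [z /andP[]//|_]; rewrite group1.
have E n k : n \in 'N(P) -> k \in 'N(P) ->
   compf (compf u.1 (compf (conjmap P k) (invf P u.1)))
     (compf u.1 (compf (conjmap P n) (invf P u.1))) =
   compf u.1 (compf (conjmap P (k * n)) (invf P u.1)).
  move=> nN kN; apply/ffunP => y; rewrite -conjmapM //.
  have ce (h k' : {ffun S -> S}) x : compf h k' x = h (k' x) by rewrite ffunE.
  rewrite !ce inv // ffunE invP memJ_norm ?groupV //.
apply/group_setP; split.
  rewrite inE group1 /=; apply/imsetP; exists 1; rewrite ?group1 //.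
  rewrite /conjm_ell; congr (_, _); last by rewrite /ell invg1 morph1 conj1g.
  apply/ffunP => y; rewrite !ffunE invg1 !conjg1.
  case: pickP => [z /andP[zP /eqP<-]|no] /=; first by rewrite zP r.
  rewrite group1 f1; case: ifP => // yQ.
  have := no (v.1 y); have := congr1 fst uv => /ffunP/(_ y).
  rewrite !ffunE yQ /= => ->.
  have := subsetP (fas_sub_U sys Q P) _ vX.
  rewrite inE => /andP[/InjP[_ _ r' _] _].
  by rewrite r' // eqxx.
move=> k n; rewrite inE => /andP[kN /imsetP[t tN [e3 e4]]].
rewrite inE => /andP[nN /imsetP[s' sN [e1 e2]]]; rewrite inE groupM //=.
apply/imsetP; exists (t * s'); first exact: groupM.
by rewrite ellM conjMg e2 e4 -(E n k) // e1 e3 /conjm_ell conjmapM // ellM.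
Qed.

Lemma extenderE P Q u : fusion_action_system -> u \in X_iso P Q ->
  extender P Q u = extender_set P Q u :> {set S}.
Proof.
by move=> sys uX; rewrite -[RHS](gen_set_id (group_set_extender sys uX)).
Qed.

Definition fully_automized P : Prop :=
  p.-Sylow(perm_pairs_of P (XX P P)) (perm_pairs_of P (AutSX P)).

Definition receiving P : Prop :=
  forall Q (u : mor), u \in X_iso Q P ->
    exists2 f : {ffun S -> S},
      (f, u.2) \in XX (extender Q P u) [set: S]%G & restr Q f = u.1.

Record saturated : Prop := Saturated {
  sat_fully : forall P,
    [/\ fully_normalized P -> fully_X_normalized P /\ fully_centralized P,
        fully_X_normalized P -> fully_X_centralized P
      & fully_centralized P -> fully_X_centralized P];
  sat_normalized : forall P, fully_normalized P ->
    [/\ p.-Sylow(perms_of P (F_hom P P)) (perms_of P (AutS P)),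
        p.-Sylow(perm_pairs_of P (XX P P)) (perm_pairs_of P (AutSX P))
      & p.-Sylow(Sigma P) (SigmaS P)];
  sat_X_normalized : forall P, fully_X_normalized P ->
    p.-Sylow(perms_of P (F0 P)) (perms_of P (FS0 P));
  sat_centralized : forall P, fully_centralized P ->
    p.-Sylow(Sigma0 P) (SigmaS0 P);
  sat_extension : forall Q, fully_X_centralized Q -> receiving Q
}.

End System.

End FusionActionSystems.

(* Main.v *)
Require Import Defs.
From mathcomp Require Import all_boot all_fingroup all_solvable.

Import GroupScope.

(** The equivalence rests on one construction.  Suppose that Q is conjugate to
    P, and that Q is fully automized and receiving.  An isomorphism u : P -> Q
    carries the p-group Aut_S(P;X) into X(Q), where Sylow's theorem moves it
    into Aut_S(Q;X); so after composing u with an automorphism of Q its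
    extender is all of N_S(P), and since Q is receiving, u extends to a
    morphism w : N_S(P) -> S with w(P) = Q
    ([normalizer_embedding_exists]).

    Such a w is injective, intertwines the actions on X, and maps N_S(P) into
    N_S(Q).  An element n of N_S(P) centralizes P exactly when w(n) centralizes
    Q, and acts trivially on X exactly when w(n) does.  Therefore w embeds each
    of N_S(P), Z_S(P), N_S(P;X), Z_S(P;X) into the corresponding subgroup for
    Q, and this Q has the largest subgroups of all four kinds in its class.
    Hence P is fully normalized, fully centralized, and so on, exactly when w
    maps the relevant subgroup of P onto that of Q, and the implications
    between these four properties are inclusions between the four subgroups
    ([fully_imply]).

    The Sylow conditions for Q follow from Q being fully automized, by
    intersecting with the normal subgroups of X(Q) that consist of the pairs
    with trivial first or second component, and then projecting.  They pass
    from Q to P by transport along w when w is onto ([sylow_nstab]).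

    For the extension property, let P be fully X-centralized and let
    u : R -> P be an isomorphism.  The composite of u with w extends to some g
    on the extender of u, because Q is receiving.  If n in the extender
    induces c_m on P, then g(n) and w(m) induce the same pair on Q, so they
    differ by an element of Z_S(Q;X) = w(Z_S(P;X)).  So g takes its values in
    the image of w, and w^-1 o g is the extension of u ([receiving_emb]).

    Conversely, in a saturated system a fully normalized member of a class is
    fully automized by definition, and it is receiving because it is fully
    centralized, hence fully X-centralized. *)

Section FusionActionSystem.

Set Implicit Arguments.
Unset Strict Implicit.

Variables (p : nat) (S : finGroupType) (X : finType) (to : {action S &-> X}).
Variable XX : homsets S X.
Hypothesis sys : fusion_action_system to XX.

Implicit Types (P Q R : {group S}) (u v w : mor S X).

Local Notation top := [set: S]%G.

(** * Morphisms and isomorphisms of a fusion action system *)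

Lemma mor_props P Q u : u \in XX P Q ->
  [/\ {in P &, {morph u.1 : x y / x * y}}, {in P &, injective u.1},
      {in P, forall x, u.1 x \in Q}, forall x, x \notin P -> u.1 x = 1
    & {in P, forall x, ell to x ^ u.2 = ell to (u.1 x)}].
Proof.
move=> /(subsetP (fas_sub_U sys P Q)); rewrite inE => /andP[/InjP[m i r s]].
by move/forall_inP=> e; split=> // x /e/eqP.
Qed.

Lemma mor_morph P Q u : u \in XX P Q -> {in P &, {morph u.1 : x y / x * y}}.
Proof. by case/mor_props. Qed.

Lemma mor_inj P Q u : u \in XX P Q -> {in P &, injective u.1}.
Proof. by case/mor_props. Qed.

Lemma mor_im P Q u : u \in XX P Q -> {in P, forall x, u.1 x \in Q}.
Proof. by case/mor_props. Qed.

Lemma mor_ell P Q u : u \in XX P Q ->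
  {in P, forall x, ell to x ^ u.2 = ell to (u.1 x)}.
Proof. by case/mor_props. Qed.

Definition mor_fun P Q u (uX : u \in XX P Q) := Morphism (mor_morph uX).

Lemma injm_mor_fun P Q u (uX : u \in XX P Q) : 'injm (mor_fun uX).
Proof. exact/injmP/(mor_inj uX). Qed.

Lemma mor1 P Q u : u \in XX P Q -> u.1 1 = 1.
Proof. by move=> uX; apply: (morph1 (mor_fun uX)). Qed.

Lemma mor_conj P Q u : u \in XX P Q ->
  {in P &, {morph u.1 : x y / x ^ y}}.
Proof. by move=> uX; apply: (morphJ (mor_fun uX)). Qed.

Lemma mor_eq P Q Q' u v : u \in XX P Q -> v \in XX P Q' ->
  {in P, u.1 =1 v.1} -> u.2 = v.2 -> u = v.
Proof.
case: u v => u1 u2 [v1 v2] /mor_props[_ _ _ su _] /mor_props[_ _ _ sv _] /= e ->.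
congr (_, _); apply/ffunP=> x; have [/e//|xP] := boolP (x \in P).
by rewrite su ?sv.
Qed.

Lemma inclm_mor P Q : P \subset Q -> inclm X P \in XX P Q.
Proof.
move=> sPQ; apply: (subsetP (fas_contains_XS sys P Q)).
apply/imsetP; exists 1; first by rewrite inE invg1 conjsg1.
rewrite /conjm_ell; congr (_, _); last by rewrite /ell invg1 morph1.
by apply/ffunP=> x; rewrite !ffunE invg1 conjg1.
Qed.

Lemma compm_fun u v x : (compm v u).1 x = v.1 (u.1 x).
Proof. by rewrite ffunE. Qed.

Lemma restrm_mor P P' Q u : P' \subset P -> u \in XX P Q ->
  (restr P' u.1, u.2) \in XX P' Q.
Proof.
move=> sP uX; have iX := inclm_mor sP.
have -> : (restr P' u.1, u.2) = compm u (inclm X P').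
  rewrite /compm /= mul1g; congr (_, _); apply/ffunP=> x; rewrite !ffunE.
  by case: ifP => // _; apply/esym/(mor1 uX).
exact: (fas_comp sys iX uX).
Qed.

Lemma iso_mor P Q u : u \in X_iso XX P Q -> u \in XX P Q.
Proof. by rewrite inE => /andP[]. Qed.

Lemma iso_inv P Q u : u \in X_iso XX P Q ->
  exists2 v, v \in X_iso XX Q P
    & [/\ {in P, cancel u.1 v.1}, {in Q, cancel v.1 u.1} & v.2 = u.2^-1].
Proof.
rewrite inE => /andP[uX /existsP[v /andP[vX /andP[vu uv]]]]; exists v.
  by rewrite inE vX; apply/existsP; exists u; rewrite uX uv vu.
move/eqP: vu; move/eqP: uv => [uv _] [vu uv2]; split.
- by move=> x xP; move/ffunP/(_ x): vu; rewrite !ffunE xP.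
- by move=> x xQ; move/ffunP/(_ x): uv; rewrite !ffunE xQ.
- by apply/esym/eqP; rewrite eq_invg_mul uv2.
Qed.

Lemma iso_im P Q u : u \in X_iso XX P Q -> u.1 @: P = Q.
Proof.
move=> uI; have uX := iso_mor uI; have [v vI [_ vK _]] := iso_inv uI.
apply/eqP; rewrite eqEsubset; apply/andP; split; apply/subsetP=> y.
  by case/imsetP=> x xP ->; rewrite (mor_im uX).
by move=> yQ; apply/imsetP; exists (v.1 y); rewrite ?vK ?(mor_im (iso_mor vI)).
Qed.

(** The factorization axiom says that each morphism, corestricted to its image,
    is an isomorphism; all the corestrictions below come from this. *)
Lemma factor_iso P Q u : u \in XX P Q ->
  exists2 R : {group S}, R \subset Q & u \in X_iso XX P R.
Proof.
move=> uX; have [R [v [sRQ vI def_u]]] := fas_factor sys uX.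
exists R => //; suffices -> : u = v by [].
apply: mor_eq uX (iso_mor vI) _ _; last by rewrite def_u /= mulg1.
by move=> x xP; rewrite def_u compm_fun ffunE (mor_im (iso_mor vI)).
Qed.

Lemma corestr_iso P Q R u : u \in XX P Q -> u.1 @: P = R -> u \in X_iso XX P R.
Proof.
move=> uX im; have [R' _ uI] := factor_iso uX.
by suffices -> : R = R' by []; apply/val_inj; rewrite /= -im (iso_im uI).
Qed.

Lemma X_isoE P Q u : (u \in X_iso XX P Q) = (u \in XX P Q) && (u.1 @: P == Q).
Proof.
apply/idP/andP=> [uI|[uX /eqP im]]; last exact: (corestr_iso uX im).
by rewrite (iso_mor uI) (iso_im uI).
Qed.

Lemma corestr_mor P Q R u : u \in XX P Q ->
  {in P, forall x, u.1 x \in R} -> u \in XX P R.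
Proof.
move=> uX imR; have [R' _ uI] := factor_iso uX.
have sR'R : R' \subset R.
  by rewrite -(iso_im uI); apply/subsetP=> _ /imsetP[x xP ->]; apply: imR.
have -> : u = compm (inclm X R') u.
  apply: mor_eq uX (fas_comp sys (iso_mor uI) (inclm_mor sR'R)) _ _.
    by move=> x xP; rewrite compm_fun ffunE (mor_im (iso_mor uI)).
  by rewrite /= mulg1.
exact: (fas_comp sys (iso_mor uI) (inclm_mor sR'R)).
Qed.

Lemma iso_comp P Q R u v : u \in X_iso XX P Q -> v \in X_iso XX Q R ->
  compm v u \in X_iso XX P R.
Proof.
rewrite !X_isoE => /andP[uX /eqP imu] /andP[vX /eqP imv].
rewrite (fas_comp sys uX vX) /= -imv -imu -imset_comp; apply/eqP/eq_imset => x.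
by rewrite compm_fun.
Qed.

Lemma X_conj_refl P : X_conjugate XX P P.
Proof.
exists (inclm X P); rewrite X_isoE inclm_mor //=; apply/eqP/setP=> x.
apply/imsetP/idP=> [[y yP ->]|xP]; first by rewrite ffunE yP.
by exists x; rewrite ?ffunE ?xP.
Qed.

Lemma X_conj_sym P Q : X_conjugate XX P Q -> X_conjugate XX Q P.
Proof. by case=> u /iso_inv[v vI _]; exists v. Qed.

Lemma X_conj_trans P Q R :
  X_conjugate XX P Q -> X_conjugate XX Q R -> X_conjugate XX P R.
Proof. by case=> u uI [v vI]; exists (compm v u); apply: iso_comp uI vI. Qed.

(** * The pairs induced by elements of S *)

(** The pair (c_s, ell_s) for s = n^-1; the inverse makes this a homomorphism in
    n, because products of permutations are read from left to right. *)
Definition conj_pair P (n : S) : {perm S} * {perm X} :=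
  (conj_aut P n, actperm to n).

Lemma conj_pair_morphM P : {in 'N(P) &, {morph conj_pair P : m n / m * n}}.
Proof.
by move=> m n mN nN; rewrite /conj_pair conj_aut_morphM // actpermM ?inE.
Qed.
Canonical conj_pair_morphism P := Morphism (@conj_pair_morphM P).

(** The group X(P), encoded in Aut P x Sym(X). *)
Definition Xaut P := Group (group_set_perm_pairs_of P sys).

Lemma ellV n : ell to n^-1 = actperm to n.
Proof. by rewrite /ell invgK. Qed.

Lemma AutE P (a b : {perm S}) : a \in Aut P -> b \in Aut P ->
  restr P a = restr P b -> a = b.
Proof.
move=> aA bA /ffunP eq_ab; apply: (eq_Aut aA bA) => x xP.
by have := eq_ab x; rewrite !ffunE xP.
Qed.

Lemma conj_aut_Aut P n : n \in 'N(P) -> conj_aut P n \in Aut P.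
Proof.
by move=> nN; apply: (subsetP (Aut_conj_aut P 'N(P))); apply: mem_morphim.
Qed.

Lemma restr_conj_aut P n : n \in 'N(P) ->
  restr P (conj_aut P n) = conjmap P n^-1.
Proof.
move=> nN; apply/ffunP=> x; rewrite !ffunE invgK.
by case: ifP => // xP; rewrite norm_conj_autE.
Qed.

Lemma conj_pairs P : perm_pairs_of P (AutSX to P) = conj_pair P @* 'N(P).
Proof.
rewrite morphimEdom; apply/setP=> -[a s]; rewrite inE /=.
apply/andP/imsetP=> [[aA /imsetP[n nN [ea es]]]|[n nN [-> ->]]].
  exists n^-1; rewrite ?groupV // /conj_pair -ellV invgK -es; congr (_, _).
  apply: (AutE aA); rewrite ?conj_aut_Aut ?restr_conj_aut ?groupV //.
  by rewrite invgK.
rewrite conj_aut_Aut //; split=> //; apply/imsetP; exists n^-1.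
  by rewrite groupV.
by rewrite /conjm_ell ellV restr_conj_aut.
Qed.

Lemma conj_pair_sub P : conj_pair P @* 'N(P) \subset Xaut P.
Proof.
rewrite -conj_pairs; apply/subsetP=> a; rewrite !inE => /andP[-> /= aS].
apply: (subsetP (fas_contains_XS sys P P)).
case/imsetP: aS => n nN ->; apply: imset_f; rewrite inE.
by rewrite (normP _) ?groupV.
Qed.


Lemma Xaut_Aut P a : a \in Xaut P -> a.1 \in Aut P.
Proof. by rewrite inE => /andP[]. Qed.

Lemma Xaut_mor P a : a \in Xaut P -> (restr P a.1, a.2) \in XX P P.
Proof. by rewrite inE => /andP[]. Qed.

(** * Transport along an isomorphism *)

(** Here th is conjugation by the isomorphism u : P -> Q.  Its first component
    is pinned down by its values on Q = u(P). *)
Definition transport_along P Q u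
    (th : {perm S} * {perm X} -> {perm S} * {perm X}) :=
  forall a, a \in Xaut P ->
  [/\ th a \in Xaut Q, {in P, forall x, (th a).1 (u.1 x) = u.1 (a.1 x)}
     & (th a).2 = a.2 ^ u.2].

(** The first component is the isomorphism Aut P -> Aut Q induced by u; the
    pair lands in X(Q) because it is the composite u a u^-1 in the category. *)
Lemma transport_exists P Q u : u \in X_iso XX P Q ->
  exists2 th : {morphism Xaut P >-> ({perm S} * {perm X})%type},
    'injm th & transport_along P Q u th.
Proof.
move=> uI; have uX := iso_mor uI; have injh := injm_mor_fun uX.
have [v vI [vu uv v2]] := iso_inv uI; have vX := iso_mor vI.
set h := mor_fun uX in injh.
pose th (a : {perm S} * {perm X}) := (Aut_isom injh (subxx P) a.1, a.2 ^ u.2).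
have thM : {in Xaut P &, {morph th : a b / a * b}}.
  move=> a b /Xaut_Aut aA /Xaut_Aut bA; rewrite /th /= conjMg.
  by congr (_, _); apply: Aut_isomM.
have hP : h @* P = Q by rewrite morphimEdom; apply: iso_im uI.
exists (Morphism thM) => [|a aX].
  apply/injmP=> a b /Xaut_Aut aA /Xaut_Aut bA [eq1 /conjg_inj eq2].
  have /injmP inj := injm_Aut_isom injh (subxx P).
  by case: a b aA bA eq1 eq2 => a1 a2 [b1 b2] /= aA bA /inj-> // ->.
have aA := Xaut_Aut aX; split=> //=; last exact: Aut_isomE.
rewrite inE /= -{1}hP Aut_Aut_isom /=.
suffices -> : (restr Q (Aut_isom injh (subxx P) a.1), a.2 ^ u.2) =
    compm u (compm (restr P a.1, a.2) v).
  exact: (fas_comp sys (fas_comp sys vX (Xaut_mor aX)) uX).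
rewrite /compm /= v2 conjgE mulgA; congr (_, _); apply/ffunP=> y.
rewrite !ffunE; case: ifP => yQ.
  have vyP := mor_im vX yQ.
  by rewrite vyP -{1}(uv y yQ); apply: Aut_isomE.
have [_ _ _ sv _] := mor_props vX.
by rewrite sv ?yQ // group1 -(autmE aA) morph1 (mor1 uX).
Qed.

(** Transport along the inverse of u is injective as well, so X(P) and X(Q)
    have the same order. *)
Lemma transport_onto P Q u
    (th : {morphism Xaut P >-> ({perm S} * {perm X})%type}) :
  u \in X_iso XX P Q -> 'injm th -> transport_along P Q u th ->
  th @* Xaut P = Xaut Q.
Proof.
move=> uI injth tth; apply/eqP; rewrite eqEcard; apply/andP; split.
  by apply/subsetP=> _ /morphimP[a _ aX ->]; case: (tth a aX).
have [v vI _] := iso_inv uI; have [th' injth' tth'] := transport_exists vI.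
rewrite card_injm // -(card_injm injth') // subset_leq_card //.
by apply/subsetP=> _ /morphimP[a _ aX ->]; case: (tth' a aX).
Qed.

(** This is u (c_n, ell_n) u^-1 = (c_m, ell_m) on u(P), written with elements
    of S and with n, m replaced by their inverses. *)
Definition carries P u n m : Prop :=
  {in P, forall x, u.1 (x ^ n) = u.1 x ^ m} /\ actperm to n ^ u.2 = actperm to m.

Lemma transport_conj_pair P Q u th n m : u \in X_iso XX P Q ->
  transport_along P Q u th -> n \in 'N(P) -> m \in 'N(Q) ->
  carries P u n m -> th (conj_pair P n) = conj_pair Q m.
Proof.
move=> uI tth nN mN [c1 c2]; have uX := iso_mor uI.
have aX : conj_pair P n \in Xaut P.
  by apply: (subsetP (conj_pair_sub P)); apply: mem_morphim.
have [/Xaut_Aut thA th1 th2] := tth _ aX.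
rewrite [th _]surjective_pairing th2 c2; congr (_, _).
apply: (eq_Aut thA (conj_aut_Aut mN)) => y yQ.
have /imsetP[x xP ->]: y \in u.1 @: P by rewrite (iso_im uI).
by rewrite th1 //= !norm_conj_autE ?c1 // (mor_im uX).
Qed.

Lemma extenderP P Q u n : u \in X_iso XX P Q ->
  n \in extender to P Q u <->
  n \in 'N(P) /\ exists2 m, m \in 'N(Q) & carries P u n m.
Proof.
move=> uI; have uX := iso_mor uI.
have invK : {in P, cancel u.1 (invf P u.1)}.
  move=> x xP; rewrite ffunE; case: pickP => [y /andP[yP /eqP]|/(_ x)].
    exact: (mor_inj uX).
  by rewrite xP eqxx.
have invK' : {in Q, cancel (invf P u.1) u.1}.
  by move=> y; rewrite -{1}(iso_im uI) => /imsetP[x xP ->]; rewrite invK.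
have invP y : invf P u.1 y \in P.
  by rewrite ffunE; case: pickP => [z /andP[]//|_]; rewrite group1.
have inv1 y : y \notin Q -> invf P u.1 y = 1.
  move=> yQ; rewrite ffunE; case: pickP => [z /andP[zP /eqP eq_y]|//].
  by rewrite -eq_y (mor_im uX) in yQ.
rewrite -groupV (extenderE sys uI) inE groupV ellV.
move: (invf P u.1) invK invK' invP inv1 => i invK invK' invP inv1.
split=> [/andP[nN /imsetP[s sN [e1 e2]]]|[nN [m mN [c1 c2]]]].
  split=> //; exists s^-1; rewrite ?groupV //; split=> [x xP|].
    have uxQ := mor_im uX xP; have /ffunP/(_ (u.1 x)) := e1.
    by rewrite !ffunE invK // xP uxQ invgK.
  by rewrite e2 -ellV invgK.
rewrite nN; apply/imsetP; exists m^-1; first by rewrite groupV.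
rewrite /conjm_ell ellV -c2; congr (_, _); apply/ffunP=> y.
rewrite !ffunE invP !invgK; case: ifP => yQ; first by rewrite c1 // invK'.
by rewrite inv1 ?yQ // conj1g (mor1 uX).
Qed.

Lemma carries_comp P Q u v n m l : u \in XX P Q ->
  carries P u n m -> carries Q v m l -> carries P (compm v u) n l.
Proof.
move=> uX [u1 u2] [v1 v2]; split=> [x xP|]; last by rewrite conjgM u2.
by rewrite !compm_fun u1 // v1 // (mor_im uX).
Qed.

Lemma carries_ell P u n m : carries P u n m -> ell to n ^ u.2 = ell to m.
Proof.
by case=> _ c; apply: invg_inj; rewrite -conjVg /ell !morphV ?inE // !invgK.
Qed.

Lemma sub_extender P Q u : u \in X_iso XX P Q -> P \subset extender to P Q u.
Proof.
move=> uI; have uX := iso_mor uI; apply/subsetP=> n nP; apply/(extenderP n uI).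
have nN := subsetP (normG P) _ nP; split=> //; exists (u.1 n).
  by rewrite (subsetP (normG Q)) // (mor_im uX).
split=> [x xP|]; first exact: (mor_conj uX).
apply: invg_inj; rewrite -conjVg; have := mor_ell uX nP.
by rewrite /ell !morphV ?inE.
Qed.

(** * Embedding a normalizer into that of a receiving subgroup *)

Definition normalizer_embedding P Q w : Prop :=
  w \in XX 'N(P)%G top /\ w.1 @: P = Q.

(** After composition with an element of X(Q) supplied by Sylow's theorem, the
    isomorphism P -> Q conjugates Aut_S(P;X) into Aut_S(Q;X); then its extender
    is N_S(P). *)
Lemma normalizer_embedding_exists P Q :
  p.-group [set: S] -> X_conjugate XX P Q ->
  fully_automized p to XX Q -> receiving to XX Q ->
  exists w, normalizer_embedding P Q w.
Proof.
move=> pS [u uI] faQ rQ; have [th injth tth] := transport_exists uI.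
rewrite /fully_automized conj_pairs in faQ.
have sTX : th @* (conj_pair P @* 'N(P)) \subset Xaut Q.
  by rewrite -(transport_onto uI injth tth) morphimS // conj_pair_sub.
have pT : p.-group (th @* (conj_pair P @* 'N(P))).
  by rewrite !morphim_pgroup // (pgroupS (subsetT _) pS).
have [a aX sTQ] := Sylow_Jsub (G := Xaut Q) faQ sTX pT.
pose v : mor S X := (restr Q a.1, a.2).
have vI : v \in X_iso XX Q Q.
  apply: (corestr_iso (Xaut_mor aX)).
  rewrite -[RHS](im_autm (Xaut_Aut aX)) morphimEdom; apply: eq_in_imset => x xQ.
  by rewrite ffunE xQ -(autmE (Xaut_Aut aX)).
have uvI := iso_comp uI vI; have uX := iso_mor uI.
have extN : extender to P Q (compm v u) = 'N(P)%G.
  apply/val_inj/eqP; rewrite eqEsubset; apply/andP; split; apply/subsetP=> n.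
    by case/(extenderP n uvI).
  move=> nN; apply/(extenderP n uvI); split=> //.
  have cX : conj_pair P n \in Xaut P.
    by apply: (subsetP (conj_pair_sub P)); apply: mem_morphim.
  have [/Xaut_Aut thA th1 th2] := tth _ cX.
  have /(subsetP sTQ)/morphimP[m _ mN def_m] :
      th (conj_pair P n) ^ a \in (th @* (conj_pair P @* 'N(P))) :^ a.
    by rewrite memJ_conjg !mem_morphim.
  exists m => //; split=> [x xP|]; last first.
    by rewrite conjgM -th2; apply: (congr1 snd def_m).
  have xnP : x ^ n \in P by rewrite memJ_norm.
  have uxQ := mor_im uX xP; have auxQ := Aut_closed (Xaut_Aut aX) uxQ.
  rewrite !compm_fun !ffunE !(mor_im uX) //= -(norm_conj_autE mN) //.
  have -> : conj_aut Q m = (th (conj_pair P n)).1 ^ a.1.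
    exact/esym/(congr1 fst def_m).
  by rewrite permJ th1 //= norm_conj_autE.
have [f fX f_ext] := rQ P _ uvI; rewrite extN in fX.
exists (f, (compm v u).2); split=> //=; rewrite -(iso_im uvI) -f_ext.
by apply: eq_in_imset => x xP; rewrite ffunE xP.
Qed.


(** * The four subgroups of a normalizer, treated uniformly *)

(** The flags c and k ask for a trivial first, respectively second,
    component. *)
Definition trivial_on (c k : bool) : {group ({perm S} * {perm X})%type} :=
  [group of setX (if c then 1%G else [set: {perm S}]%G)
                 (if k then 1%G else [set: {perm X}]%G)].

Lemma trivial_onE c k (a : {perm S} * {perm X}) :
  (a \in trivial_on c k) = (c ==> (a.1 == 1)) && (k ==> (a.2 == 1)).
Proof. by rewrite inE; case: c; case: k; rewrite !inE. Qed.

Lemma trivial_on_norm c k (A : {set {perm S} * {perm X}}) :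
  A \subset 'N(trivial_on c k).
Proof.
apply/subsetP=> a _; rewrite inE; apply/subsetP=> _ /imsetP[b bL ->].
by move: bL; rewrite !trivial_onE /= !conjg_eq1.
Qed.

(** As (c, k) varies, these are N_S(P), N_S(P;X), Z_S(P) and Z_S(P;X), so that
    statements about the four of them are proved once. *)
Definition nstab (c k : bool) P : {group S} := (conj_pair P @*^-1 trivial_on c k)%G.

Lemma nstab_sub c k P : nstab c k P \subset 'N(P).
Proof. exact: subsetIl. Qed.

Lemma nstabE c k P n : n \in 'N(P) ->
  (n \in nstab c k P) = (c ==> (n \in 'C(P))) && (k ==> (n \in kerX to)).
Proof.
move=> nN; rewrite in_setI nN in_set trivial_onE /= -ellV.
congr (_ && (_ ==> _)); last by rewrite inE ellV /ell morphV ?inE //= eq_invg1.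
by rewrite -ker_conj_aut in_setI nN in_set in_set1.
Qed.

Lemma nstab_out c k P n : n \notin 'N(P) -> (n \in nstab c k P) = false.
Proof. by move=> nN; apply: contraNF nN; apply: (subsetP (nstab_sub _ _ _)). Qed.

Lemma nstab_norm P : nstab false false P = 'N(P) :> {set S}.
Proof.
by apply/eqP; rewrite eqEsubset nstab_sub; apply/subsetP=> n nN; rewrite nstabE.
Qed.

Lemma nstab_NX P : nstab false true P = NX to P :> {set S}.
Proof.
apply/setP=> n; have [nN|nN] := boolP (n \in 'N(P)).
  by rewrite nstabE // in_setI nN.
by rewrite nstab_out // in_setI (negPf nN).
Qed.

Lemma nstab_cent P : nstab true false P = 'C(P) :> {set S}.
Proof.
apply/setP=> n; have [nN|nN] := boolP (n \in 'N(P)).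
  by rewrite nstabE // andbT.
rewrite nstab_out //; apply/esym/(contraNF _ nN).
exact: (subsetP (cent_sub P)).
Qed.

Lemma nstab_ZX P : nstab true true P = ZX to P :> {set S}.
Proof.
apply/setP=> n; have [nN|nN] := boolP (n \in 'N(P)).
  by rewrite nstabE // in_setI.
rewrite nstab_out // in_setI; apply/esym/andP => -[cn _].
by rewrite (subsetP (cent_sub P)) in nN.
Qed.

Definition fully c k P : Prop :=
  forall Q, X_conjugate XX P Q -> #|nstab c k Q| <= #|nstab c k P|.

Lemma fully_normalizedE P : fully_normalized XX P <-> fully false false P.
Proof. by split=> H Q /H; rewrite !nstab_norm. Qed.

Lemma fully_centralizedE P : fully_centralized XX P <-> fully true false P.
Proof. by split=> H Q /H; rewrite !nstab_cent. Qed.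

Lemma fully_X_normalizedE P : fully_X_normalized to XX P <-> fully false true P.
Proof. by split=> H Q /H; rewrite !nstab_NX. Qed.

Lemma fully_X_centralizedE P : fully_X_centralized to XX P <-> fully true true P.
Proof. by split=> H Q /H; rewrite !nstab_ZX. Qed.

(** * Consequences of a normalizer embedding *)

Section Embedding.

Variables (P Q : {group S}) (w : mor S X).
Hypothesis emb : normalizer_embedding P Q w.

Let wX : w \in XX 'N(P)%G top := emb.1.
Let imw : w.1 @: P = Q := emb.2.

Lemma emb_iso : (restr P w.1, w.2) \in X_iso XX P Q.
Proof.
apply: corestr_iso (restrm_mor (normG P) wX) _.
by rewrite -imw; apply: eq_in_imset => x xP; rewrite ffunE xP.
Qed.

Lemma emb_P x : x \in P -> w.1 x \in Q.
Proof. by move=> xP; rewrite -imw imset_f. Qed.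

Lemma emb_conj x n : x \in P -> n \in 'N(P) -> w.1 (x ^ n) = w.1 x ^ w.1 n.
Proof.
by move=> xP; apply: (mor_conj wX); apply: (subsetP (normG P)).
Qed.

Lemma emb_norm n : n \in 'N(P) -> w.1 n \in 'N(Q).
Proof.
move=> nN; rewrite inE; apply/subsetP=> _ /imsetP[y yQ ->].
move: yQ; rewrite -{1}imw => /imsetP[x xP ->].
by rewrite -emb_conj // emb_P // memJ_norm.
Qed.

Lemma emb_carries n : n \in 'N(P) -> carries P (restr P w.1, w.2) n (w.1 n).
Proof.
move=> nN; split=> [x xP|] /=.
  by rewrite !ffunE memJ_norm // xP emb_conj.
apply: invg_inj; rewrite -conjVg; have := mor_ell wX nN.
by rewrite /ell !morphV ?inE.
Qed.

Lemma emb_nstab c k n : n \in 'N(P) ->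
  (w.1 n \in nstab c k Q) = (n \in nstab c k P).
Proof.
move=> nN; rewrite !nstabE ?emb_norm //; congr (_ && _); congr (_ ==> _).
  apply/centP/centP=> cn x.
    move=> xP; have := cn _ (emb_P xP); rewrite /commute => e.
    by apply: (mor_inj wX); rewrite ?(mor_morph wX) ?groupM // ?(subsetP (normG P)).
  rewrite -{1}imw => /imsetP[y yP ->]; rewrite /commute.
  have yN := subsetP (normG P) _ yP.
  by rewrite -!(mor_morph wX) // cn.
by rewrite !inE -(mor_ell wX nN) conjg_eq1.
Qed.

Lemma emb_card c k : #|w.1 @: nstab c k P| = #|nstab c k P|.
Proof.
apply: card_in_imset => x y /(subsetP (nstab_sub _ _ _)) xN.
by move/(subsetP (nstab_sub _ _ _)); apply: (mor_inj wX).
Qed.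

Lemma emb_nstab_sub c k : w.1 @: nstab c k P \subset nstab c k Q.
Proof.
apply/subsetP=> _ /imsetP[n nP ->]; rewrite emb_nstab //.
exact: (subsetP (nstab_sub _ _ _) _ nP).
Qed.

Lemma emb_nstab_leq c k : #|nstab c k P| <= #|nstab c k Q|.
Proof. by rewrite -emb_card subset_leq_card // emb_nstab_sub. Qed.

(** The subgroup of Q is no larger than that of P, and w embeds the latter into
    the former. *)
Lemma fully_onto c k : fully c k P -> w.1 @: nstab c k P = nstab c k Q.
Proof.
move=> fP; apply/eqP; rewrite eqEcard emb_nstab_sub emb_card /=; apply: fP.
by exists (restr P w.1, w.2); apply: emb_iso.
Qed.

(** Larger flags cut out a smaller subgroup, and w preserves and reflects the
    conditions that cut it out. *)
Lemma onto_imply c k c' k' : c ==> c' -> k ==> k' ->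
  w.1 @: nstab c k P = nstab c k Q -> w.1 @: nstab c' k' P = nstab c' k' Q.
Proof.
move=> cc' kk' onto; apply/eqP; rewrite eqEsubset emb_nstab_sub.
apply/subsetP=> y yQ; have yN := subsetP (nstab_sub _ _ _) _ yQ.
have: y \in nstab c k Q.
  move: yQ; rewrite !nstabE // => /andP[/implyP h1 /implyP h2].
  apply/andP; split; apply/implyP=> b; first exact/h1/(implyP cc').
  exact/h2/(implyP kk').
rewrite -onto => /imsetP[n nP eq_y]; rewrite eq_y in yQ *; apply: imset_f.
by rewrite -emb_nstab // (subsetP (nstab_sub _ _ _) _ nP).
Qed.

(** The subgroup of X(Q) with the prescribed trivial components is normal, so a
    Sylow subgroup of X(Q) meets it in a Sylow subgroup.  Transport along w
    identifies this intersection with its analogue for P. *)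
Lemma sylow_nstab c k : fully_automized p to XX Q ->
  w.1 @: nstab c k P = nstab c k Q ->
  p.-Sylow(Xaut P :&: trivial_on c k) (conj_pair P @* nstab c k P).
Proof.
move=> faQ onto; have [th injth tth] := transport_exists emb_iso.
have thc n : n \in 'N(P) -> th (conj_pair P n) = conj_pair Q (w.1 n).
  move=> nN; apply/(transport_conj_pair emb_iso tth nN (emb_norm nN)).
  exact: emb_carries.
have sKX : conj_pair P @* nstab c k P \subset Xaut P.
  by apply: subset_trans (conj_pair_sub P); rewrite morphimS ?nstab_sub.
rewrite -(injm_pHall injth) ?subsetIl //.
have -> : th @* (conj_pair P @* nstab c k P) = conj_pair Q @* nstab c k Q.
  rewrite -onto; apply/setP=> b; apply/morphimP/morphimP.
    case=> _ _ /morphimP[n nN nP ->] ->; exists (w.1 n); rewrite ?emb_norm //.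
      exact: imset_f.
    exact: thc.
  case=> _ _ /imsetP[n nP ->] ->; have nN := subsetP (nstab_sub _ _ _) _ nP.
  by exists (conj_pair P n); rewrite ?thc // ?(subsetP sKX) ?mem_morphim.
have -> : th @* (Xaut P :&: trivial_on c k) = Xaut Q :&: trivial_on c k.
  rewrite -(transport_onto emb_iso injth tth); apply/setP=> b.
  suffices th_triv a : a \in Xaut P ->
      (th a \in trivial_on c k) = (a \in trivial_on c k).
    apply/idP/idP.
      case/morphimP=> a aX /setIP[_ aL] ->.
      by rewrite inE th_triv // aL mem_morphim.
    case/setIP=> /morphimP[a aX _ ->]; rewrite th_triv // => aL.
    by rewrite mem_morphim // inE aX.
  move=> aX; have [thX th1 th2] := tth a aX.
  rewrite !trivial_onE th2 conjg_eq1; congr ((_ ==> _) && _).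
  have aA := Xaut_Aut aX.
  apply/eqP/eqP=> e.
    apply: (eq_Aut aA (group1 _)) => x xP; rewrite perm1.
    have := th1 x xP; rewrite e perm1 => /(mor_inj (iso_mor emb_iso)) inj.
    by rewrite -inj // (Aut_closed aA xP).
  apply: (eq_Aut (Xaut_Aut thX) (group1 _)) => y yQ.
  have /imsetP[x xP ->]: y \in (restr P w.1) @: P by rewrite (iso_im emb_iso).
  by rewrite th1 // e !perm1.
have -> : conj_pair Q @* nstab c k Q =
    (Xaut Q :&: trivial_on c k) :&: conj_pair Q @* 'N(Q).
  have -> : nstab c k Q = 'N(Q) :&: conj_pair Q @*^-1 trivial_on c k :> {set S}.
    exact/esym/morphpreIdom.
  rewrite morphim_setIpre setIC -setIA [trivial_on _ _ :&: _]setIC setIA.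
  by rewrite (setIidPr (conj_pair_sub Q)).
apply: (Sylow_setI_normal (H := Xaut Q)); last first.
  by move: faQ; rewrite /fully_automized conj_pairs.
by rewrite /normal subsetIl normsI ?normG ?trivial_on_norm.
Qed.


(** An isomorphism u onto P is extended by extending w o u, which Q allows, and
    pulling the result back along w.  Full X-centralization of P enters through
    Z_S(Q;X) = w(Z_S(P;X)), which keeps the extension inside the image of
    w. *)
Lemma receiving_emb :
  receiving to XX Q -> fully true true P -> receiving to XX P.
Proof.
move=> rQ fP R u uI; have uX := iso_mor uI; have onto := fully_onto fP.
pose v := compm (restr P w.1, w.2) u.
have vI : v \in X_iso XX R Q := iso_comp uI emb_iso.
have v1 : {in R, forall x, v.1 x = w.1 (u.1 x)}.
  by move=> x xR; rewrite compm_fun ffunE (mor_im uX).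
have [f fX f_ext] := rQ R v vI; have fR : {in R, f =1 v.1}.
  by move=> x xR; rewrite -f_ext ffunE xR.
have sNN : extender to R P u \subset extender to R Q v.
  apply/subsetP=> n /(extenderP n uI)[nN [m mN c]]; apply/(extenderP n vI).
  split=> //; exists (w.1 m); first exact: emb_norm.
  exact: carries_comp uX c (emb_carries mN).
have sRN := sub_extender uI; set N := extender to R P u in sNN sRN *.
have gX := restrm_mor sNN fX; set g := (restr N _, _) in gX.
have [T _ wI] := factor_iso wX; have [w' w'I [w'K _ w'2]] := iso_inv wI.
(* f n and w m induce the same pair on Q, hence differ by an element of
   Z_S(Q;X), which is the image under w of an element z of Z_S(P;X). *)
have g_im : {in N, forall n, exists2 k, k \in 'N(P) & g.1 n = w.1 k}.
  move=> n nN; have [nNR [m mN c]] := (extenderP n uI).1 nN.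
  have wmN := emb_norm mN.
  have cf : carries R v n (w.1 m) := carries_comp uX c (emb_carries mN).
  have nE := subsetP sNN _ nN.
  have zZ : f n * (w.1 m)^-1 \in nstab true true Q.
    have cz : f n * (w.1 m)^-1 \in 'C(Q).
      apply/centP=> y yQ; rewrite /commute [RHS]conjgC; congr (_ * _).
      have /imsetP[x xR def_y]: y \in v.1 @: R by rewrite (iso_im vI).
      have xE := subsetP sNN _ (subsetP sRN _ xR).
      have fJ : f (x ^ n) = f x ^ f n := mor_conj fX xE nE.
      have eq_act : y ^ f n = y ^ w.1 m.
        by rewrite {1}def_y -fR // -fJ fR ?memJ_norm // cf.1 // -def_y.
      by rewrite conjgM eq_act conjgK.
    rewrite nstabE ?(subsetP (cent_sub Q)) // cz inE ellM.
    rewrite -(mor_ell fX nE : _ = ell to (f n)).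
    rewrite (carries_ell cf) -ellM mulgV.
    by rewrite /ell invg1 morph1 eqxx.
  have: f n * (w.1 m)^-1 \in w.1 @: nstab true true P by rewrite onto.
  case/imsetP=> z zP eq_z; have zN := subsetP (nstab_sub _ _ _) _ zP.
  exists (z * m); first exact: groupM.
  by rewrite (mor_morph wX) // -eq_z mulgKV /= ffunE nN.
have gT : g \in XX N T.
  apply: (corestr_mor gX) => n /g_im[k kN ->].
  by rewrite (mor_im (iso_mor wI)).
have hX := fas_comp sys gT (iso_mor w'I).
exists (compm w' g).1.
  have -> : ((compm w' g).1, u.2) = compm w' g.
    by rewrite /compm /= w'2 mulgK.
  by apply: (corestr_mor hX) => n; rewrite inE.
have [_ _ _ su _] := mor_props uX.
apply/ffunP=> x; rewrite ffunE; case: ifP => xR; last by rewrite su ?xR.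
rewrite compm_fun /= ffunE (subsetP sRN) // fR // v1 // w'K //.
by rewrite (subsetP (normG P)) // (mor_im uX).
Qed.

End Embedding.

(** * The Sylow conditions as images under the two projections *)

Lemma fst_Xaut P : (@fst _ _) @* Xaut P = perms_of P (F_hom XX P P).
Proof.
rewrite morphimEsub ?subsetT //; apply/setP=> a.
rewrite in_set [X in _ && X]in_set.
apply/imsetP/andP=> [[[b s] /= bX ->]|[aA /existsP[s asX]]].
  split; first exact: (Xaut_Aut bX).
  by apply/existsP; exists s; apply: (Xaut_mor bX).
by exists (a, s) => //; rewrite in_set /= aA.
Qed.

Lemma snd_Xaut P : (@snd _ _) @* Xaut P = Sigma XX P.
Proof.
rewrite morphimEsub ?subsetT //; apply/setP=> s; rewrite !inE.
apply/imsetP/existsP=> [[[b t] /= bX ->]|[f fsX]].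
  by exists (restr P b); apply: (Xaut_mor bX).
by have [a asX _] := perm_pairs_of_surj sys fsX; exists (a, s).
Qed.

Lemma fst_Xaut_triv P :
  (@fst _ _) @* (Xaut P :&: trivial_on false true) = perms_of P (Defs.F0 XX P).
Proof.
rewrite morphimEsub ?subsetT //; apply/setP=> a.
rewrite in_set [X in _ && X]in_set.
apply/imsetP/andP=> [[[b s] /setIP[bX]]|[aA asX]].
  rewrite trivial_onE /= => /eqP s1 ->; split; first exact: (Xaut_Aut bX).
  by rewrite -s1; apply: (Xaut_mor bX).
by exists (a, 1); rewrite // in_setI trivial_onE eqxx andbT in_set /= aA.
Qed.

Lemma snd_Xaut_triv P :
  (@snd _ _) @* (Xaut P :&: trivial_on true false) = Sigma0 XX P.
Proof.
have r1 : restr P (1 : {perm S}) = incl P by apply/ffunP=> x; rewrite !ffunE perm1.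
rewrite morphimEsub ?subsetT //; apply/setP=> s; rewrite inE -r1.
apply/imsetP/idP=> [[[b t] /setIP[bX]]|sX].
  by rewrite trivial_onE andbT => /eqP /= b1 ->; rewrite -b1; apply: (Xaut_mor bX).
by exists (1, s); rewrite // in_setI trivial_onE eqxx andbT in_set group1.
Qed.

Lemma fst_conj_pair P (A : {group S}) : A \subset 'N(P) ->
  (@fst _ _) @* (conj_pair P @* A) = perms_of P [set conjmap P s | s in A].
Proof.
move=> sAN; rewrite -morphim_comp morphimEsub; last first.
  by apply: subset_trans sAN _; rewrite /= morphpreT.
apply/setP=> a; rewrite in_set.
apply/imsetP/andP=> [[n nA ->]|[aA /imsetP[n nA e]]].
  have nN := subsetP sAN _ nA; rewrite conj_aut_Aut //; split=> //.
  by apply/imsetP; exists n^-1; rewrite ?groupV ?restr_conj_aut.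
exists n^-1; rewrite ?groupV //; have nN := subsetP sAN _ nA.
apply: (AutE aA); rewrite /= ?conj_aut_Aut ?restr_conj_aut ?invgK ?groupV //.
Qed.

Lemma snd_conj_pair P (A : {group S}) : A \subset 'N(P) ->
  (@snd _ _) @* (conj_pair P @* A) = [set ell to s | s in A].
Proof.
move=> sAN; rewrite -morphim_comp morphimEsub; last first.
  by apply: subset_trans sAN _; rewrite /= morphpreT.
apply/setP=> a; apply/imsetP/imsetP=> -[n nA ->]; exists n^-1; rewrite ?groupV //=.
by rewrite ellV.
Qed.

(** * Saturation *)

Lemma X_conj_fully_normalized P :
  exists2 Q, X_conjugate XX P Q & fully_normalized XX Q.
Proof.
pose conj_to (Q : {group S}) := [exists u, u \in X_iso XX P Q].
have conjP Q : reflect (X_conjugate XX P Q) (conj_to Q) by apply: existsP.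
have PP : conj_to P by apply/conjP/X_conj_refl.
have [Q /conjP PQ maxQ] := arg_maxnP (fun Q : {group S} => #|'N(Q)|) PP.
exists Q => // R QR; apply: maxQ; apply/conjP; exact: X_conj_trans PQ QR.
Qed.

Lemma saturated_class P : saturated p to XX ->
  exists2 Q, X_conjugate XX P Q & fully_automized p to XX Q /\ receiving to XX Q.
Proof.
move=> sat; have [Q PQ nQ] := X_conj_fully_normalized P; exists Q => //.
have [_ fa _] := sat_normalized sat nQ; split=> //.
have [nc _ cx] := sat_fully sat Q.
exact/(sat_extension sat)/cx/(nc nQ).2.
Qed.

(** The subgroup of Q bounds that of every conjugate R of P, by a normalizer
    embedding for R, and the fullness of P makes the subgroup of P as large. *)
Lemma fully_imply P Q w c k c' k' :
  p.-group [set: S] -> fully_automized p to XX Q -> receiving to XX Q ->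
  normalizer_embedding P Q w -> c ==> c' -> k ==> k' ->
  fully c k P -> fully c' k' P.
Proof.
move=> pS faQ rQ emb cc' kk' fP R PR.
have PQ : X_conjugate XX P Q by exists (restr P w.1, w.2); apply: emb_iso.
have RQ := X_conj_trans (X_conj_sym PR) PQ.
have [w' emb'] := normalizer_embedding_exists pS RQ faQ rQ.
apply: leq_trans (emb_nstab_leq emb' c' k') _.
by rewrite -(onto_imply emb cc' kk' (fully_onto emb fP)) (emb_card emb).
Qed.

Lemma saturated_of_class : p.-group [set: S] ->
  (forall P : {group S}, exists2 Q : {group S},
     X_conjugate XX P Q & fully_automized p to XX Q /\ receiving to XX Q) ->
  saturated p to XX.
Proof.
move=> pS class.
have emb P : exists Q w, [/\ fully_automized p to XX Q, receiving to XX Q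
    & normalizer_embedding P Q w].
  have [Q PQ [faQ rQ]] := class P.
  by have [w embw] := normalizer_embedding_exists pS PQ faQ rQ; exists Q, w.
have imply c k c' k' P : c ==> c' -> k ==> k' -> fully c k P -> fully c' k' P.
  by have [Q [w [faQ rQ embw]]] := emb P; apply: fully_imply embw.
have sylow c k P : fully c k P ->
    p.-Sylow(Xaut P :&: trivial_on c k) (conj_pair P @* nstab c k P).
  have [Q [w [faQ _ embw]]] := emb P => fP.
  exact: (sylow_nstab embw faQ (fully_onto embw fP)).
split=> [P|P|P|P|P].
- split=> [/fully_normalizedE fP|/fully_X_normalizedE fP|/fully_centralizedE fP].
  + by split; [apply/fully_X_normalizedE|apply/fully_centralizedE]; apply: imply fP.
  + by apply/fully_X_centralizedE; apply: imply fP.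
  + by apply/fully_X_centralizedE; apply: imply fP.
- move/fully_normalizedE/sylow; rewrite nstab_norm.
  have -> : Xaut P :&: trivial_on false false = Xaut P.
    by apply/setIidPl/subsetP=> a _; rewrite trivial_onE.
  move=> sylP; split; last 1 first.
  + rewrite -snd_Xaut /SigmaS -(snd_conj_pair (subxx 'N(P))).
    by apply: morphim_pHall sylP; rewrite subsetT.
  + rewrite -fst_Xaut /AutS -(fst_conj_pair (subxx 'N(P))).
    by apply: morphim_pHall sylP; rewrite subsetT.
  + by rewrite conj_pairs.
- move/fully_X_normalizedE/sylow=> sylP.
  rewrite -fst_Xaut_triv /FS0 -nstab_NX -(fst_conj_pair (nstab_sub _ _ P)).
  by apply: morphim_pHall sylP; rewrite subsetT.
- move/fully_centralizedE/sylow=> sylP.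
  rewrite -snd_Xaut_triv /SigmaS0 -nstab_cent -(snd_conj_pair (nstab_sub _ _ P)).
  by apply: morphim_pHall sylP; rewrite subsetT.
- move/fully_X_centralizedE=> fP; have [Q [w [_ rQ embw]]] := emb P.
  exact: (receiving_emb embw rQ fP).
Qed.

End FusionActionSystem.

Theorem theorem2p5p2 (p : nat) (S : finGroupType) (X : finType)
    (to : {action S &-> X}) (XX : homsets S X) :
  prime p -> p.-group [set: S] -> fusion_action_system to XX ->
  (saturated p to XX <->
   forall P : {group S}, exists2 Q : {group S},
     X_conjugate XX P Q & fully_automized p to XX Q /\ receiving to XX Q).
Proof.
move=> _ pS sys; split=> [sat P|]; first exact: saturated_class sys P sat.
exact: saturated_of_class.
Qed.
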